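(* Let $F=Z_0^6+Z_1^6+\cdots+Z_5^6$. Let $q\in\{0,1,2\}$ and let $A\in R^{6q}$ satisfy $T^{(q)}(A)=0$. Then the output $v=(v_0,\ldots,v_5)$ on input $(q,A)$ of the recursive construction described in the context satisfies $$F^{q+1}\ \Big|\ A-q\cdot dF(v)+F\cdot\operatorname{div}(v)$$ in the local ring $\mathbb{C}[Z_0,\ldots,Z_5]_{(F)}$.
   Context: $R^k$ denotes the space of homogeneous polynomials of degree $k$ in $\mathbb{C}[Z_0,\ldots,Z_5]$. A tuple $v=(v_0,\ldots,v_5)$ of homogeneous rational functions of degree $6q-5$ with denominators not in $(F)$ is identified with the vector field $\sum_iv_i\frac{\partial}{\partial Z_i}$; $dF(v)=\sum_iv_i\frac{\partial F}{\partial Z_i}$ and $\operatorname{div}(v)=\sum_i\frac{\partial v_i}{\partial Z_i}$. $\mathbb{C}[Z_0,\ldots,Z_5]_{(F)}$ is the localization at the prime ideal $(F)$. Fix an arbitrary monomial order on $\mathbb{C}[Z_0,\ldots,Z_5]$. Multivariate division with remainder is with respect to the ordered tuple $\left(\frac{\partial F}{\partial Z_0},\ldots,\frac{\partial F}{\partial Z_5}\right)=(6Z_0^5,\ldots,6Z_5^5)$, always dividing a term by the applicable divisor of smallest index. For $q>0$, $T:R^{6q}\to R^{6(q-1)}$ divides $\frac{A}{q}=\sum_{i=0}^5v'_i\frac{\partial F}{\partial Z_i}+r$ and outputs $\operatorname{div}(v')$; $T^{(q)}$ is the $q$-fold iterate $R^{6q}\to R^0$ (with $T^{(0)}$ the identity).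 For $I\subset\{0,\ldots,5\}$ and $a=(a_0,\ldots,a_5)$, put $w_I(a)=\sum_{i\in I}a_i$, $\nu_I=\sum_{i\in I}Z_i\frac{\partial}{\partial Z_i}$ and $\nu_I(F)=dF(\nu_I)$. Reduced construction. Input: $q\in\{1,2\}$ and $B=\sum_ac_aZ^a\in R^{6q}$ all of whose monomials have all exponents at most $4$. For each monomial $c_aZ^a$ of $B$, choose a nonempty proper subset $I_a\subset\{0,\ldots,5\}$ with $w_{I_a}(a)+|I_a|=6$ (such a subset always exists). Output: $\sum_ac_aZ^a\cdot\frac{\nu_{I_a}}{q\cdot\nu_{I_a}(F)}$. Full recursive construction. Input: $q\in\{0,1,2\}$ and $A\in R^{6q}$ with $T^{(q)}(A)=0$. If $q=0$, return $v=(0,0,0,0,0,0)$. Otherwise: divide to get $\frac{A}{q}=\sum_{i=0}^5v'_i\frac{\partial F}{\partial Z_i}+r$; call this construction recursively on $(q-1,\operatorname{div}(v'))$ to get $v''$; call the reduced construction on $(q,q\cdot r)$ to get $v'''$; output $v=v'+F\cdot v''+v'''$. *)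

(* Defs.v *)
From mathcomp Require Import all_boot all_order all_algebra fraction generic_quotient.
From mathcomp Require Import complex mpoly.
From mathcomp Require Import reals.
From mathcomp Require Import ring.

Set Implicit Arguments.
Unset Strict Implicit.
Unset Printing Implicit Defensive.

Import GRing.Theory.
Local Open Scope ring_scope.

Record monomial_order (n : nat) (le : rel 'X_{1..n}) : Prop := MonomialOrder {
  monomial_order_refl : reflexive le;
  monomial_order_anti : antisymmetric le;
  monomial_order_trans : transitive le;
  monomial_order_total : total le;
  monomial_order_compat : forall m m1 m2 : 'X_{1..n},
    le m1 m2 -> le (m1 + m)%MM (m2 + m)%MM;
  monomial_order_wf : well_founded (fun m1 m2 => le m1 m2 && (m1 != m2))
}.

Section Division.
Variables (n k : nat) (K : fieldType) (le : rel 'X_{1..n}).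

(* The library's [mlead] is tied to the degree-lexicographic order. *)
Definition lead_mon (p : {mpoly K[n]}) : 'X_{1..n} :=
  head 0%MM (sort (fun m1 m2 => le m2 m1) (msupp p)).

(* State: (what is left to divide, quotients, remainder).  [enum 'I_k] is
   increasing, so the divisor used is the applicable one of smallest index;
   [(m1 <= m2)%MM] is divisibility of monomials. *)
Definition mdiv_step (f : 'I_k -> {mpoly K[n]})
    (s : {mpoly K[n]} * 'rV[{mpoly K[n]}]_k * {mpoly K[n]}) :=
  let: (p, quo, rem) := s in
  if p == 0 then s else
  let m := lead_mon p in
  if ohead [seq i <- enum 'I_k | (lead_mon (f i) <= m)%MM] is Some i then
    let u : {mpoly K[n]} :=
      (p@_m / (f i)@_(lead_mon (f i))) *: 'X_[m - lead_mon (f i)] in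
    (p - u * f i, quo + u *: delta_mx 0 i, rem)
  else (p - p@_m *: 'X_[m], quo, rem + p@_m *: 'X_[m]).

(* Only meant for divisors that are nonzero terms: each step then removes
   exactly the leading term of what is left, so that [size (msupp p)] steps
   exhaust the dividend; see [mdivision_spec]. *)
Definition mdivision_state (f : 'I_k -> {mpoly K[n]}) (p : {mpoly K[n]}) :=
  iter (size (msupp p)) (mdiv_step f) (p, 0, 0).

Definition mdiv_quo f p := (mdivision_state f p).1.2.
Definition mdiv_rem f p := (mdivision_state f p).2.

Lemma lead_mon_supp (p : {mpoly K[n]}) : p != 0 -> lead_mon p \in msupp p.
Proof.
move=> p0; rewrite /lead_mon -(mem_sort (fun m1 m2 => le m2 m1)).
have: sort (fun m1 m2 => le m2 m1) (msupp p) != [::].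
  by rewrite -size_eq0 size_sort size_eq0 msupp_eq0.
by case: (sort _ _) => //= a l _; rewrite mem_head.
Qed.

Lemma lead_mon_max (p : {mpoly K[n]}) m : monomial_order le -> m \in msupp p -> le m (lead_mon p).
Proof.
move=> le_mo; rewrite -(mem_sort (fun m1 m2 => le m2 m1)) /lead_mon.
have: sorted (fun m1 m2 => le m2 m1) (sort (fun m1 m2 => le m2 m1) (msupp p)).
  by apply: sort_sorted => x y; rewrite orbC (monomial_order_total le_mo).
case: (sort _ _) => //= a l /order_path_min al; rewrite inE => /predU1P[->|ml].
  exact: monomial_order_refl.
apply: (allP (al _)) => // x y z lexy lezx.
exact: (monomial_order_trans le_mo lezx lexy).
Qed.

Lemma lead_monZX (c : K) a : c != 0 -> lead_mon (c *: 'X_[a] : {mpoly K[n]}) = a.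
Proof.
move=> c0; have: lead_mon (c *: 'X_[a] : {mpoly K[n]}) \in msupp (c *: 'X_[a]).
  apply: lead_mon_supp; apply/eqP => /(congr1 (mcoeff a)).
  by rewrite mcoeffZ mcoeffX eqxx mulr1 mcoeff0 => /eqP; rewrite (negPf c0).
by move=> /msuppZ_le; rewrite msuppX inE => /eqP.
Qed.

Lemma size_msupp_sub (p : {mpoly K[n]}) m :
  m \in msupp p -> (size (msupp (p - p@_m *: 'X_[m])) < size (msupp p))%N.
Proof.
move=> mp; rewrite (perm_size (perm_to_rem mp)) /= ltnS uniq_leq_size //.
move=> x; rewrite mcoeff_msupp mcoeffB mcoeffZ mcoeffX.
rewrite (mem_rem_uniq _ (msupp_uniq p)) inE /= mcoeff_msupp.
by case: (eqVneq x m) => [->|_]; rewrite ?mulr1 ?subrr ?eqxx // mulr0 subr0.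
Qed.

Lemma mdivision_spec (f : 'I_k -> {mpoly K[n]}) (p : {mpoly K[n]}) :
    (forall i, exists2 c, c != 0 & exists a, f i = c *: 'X_[a]) ->
  (mdivision_state f p).1.1 = 0 /\
  p = \sum_i (mdiv_quo f p) 0 i * f i + mdiv_rem f p /\
  (forall m i, m \in msupp (mdiv_rem f p) -> ~~ (lead_mon (f i) <= m)%MM).
Proof.
move=> fE; rewrite /mdiv_quo /mdiv_rem /mdivision_state.
pose inv (s : {mpoly K[n]} * 'rV[{mpoly K[n]}]_k * {mpoly K[n]}) :=
  p = s.1.1 + \sum_i s.1.2 0 i * f i + s.2 /\
  (forall m i, m \in msupp s.2 -> ~~ (lead_mon (f i) <= m)%MM).
suff main N s : (size (msupp s.1.1) <= N)%N -> inv s ->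
    (iter N (mdiv_step f) s).1.1 = 0 /\ inv (iter N (mdiv_step f) s).
  have [||p0 [pE ?]] := main (size (msupp p)) (p, 0, 0) => //=.
    split=> [|m i] /=; last by rewrite msupp0.
    by rewrite addr0 big1 ?addr0 // => i _; rewrite mxE mul0r.
  by split=> //; split; rewrite // {1}pE p0 add0r.
elim: N s => [|N IH] s.
  by rewrite leqn0 size_eq0 msupp_eq0 /= => /eqP.
rewrite iterSr => sN invs.
have [s0|s0] := eqVneq s.1.1 0.
  have -> : mdiv_step f s = s by case: s s0 {sN invs} => [[p1 q1] r1] /= ->; rewrite eqxx.
  by apply: IH; rewrite // s0 msupp0.
case: s s0 sN invs => [[p1 q1] r1] /= p10 sN [pE rE]; rewrite (negPf p10).
have mp := lead_mon_supp p10; set m := lead_mon p1 in mp *.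
have szN : (size (msupp (p1 - p1@_m *: 'X_[m])) <= N)%N.
  by rewrite -ltnS (leq_trans _ sN) // size_msupp_sub.
case E : (ohead _) => [i|].
  have fim : (lead_mon (f i) <= m)%MM.
    suff: i \in [seq i <- enum 'I_k | (lead_mon (f i) <= m)%MM].
      by rewrite mem_filter => /andP[].
    by case: (filter _ _) E => //= a l [->]; rewrite mem_head.
  set u := _ *: _.
  have uf : u * f i = p1@_m *: 'X_[m].
    rewrite /u; case: (fE i) fim => c c0 [a ->]; rewrite lead_monZX // => am.
    rewrite mcoeffZ mcoeffX eqxx mulr1 -scalerAl -scalerAr scalerA -mpolyXD.
    by rewrite submK // divfK.
  apply: IH; rewrite /= ?uf //; split=> //=.
  rewrite (eq_bigr (fun j => q1 0 j * f j + (if j == i then u * f i else 0))).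
    rewrite big_split /= -big_mkcond /= big_pred1_eq uf pE.
    by rewrite [X in _ = _ + X + _]addrC addrA subrK.
  move=> j _; rewrite !mxE eqxx /= mulrDl; case: eqVneq => [->|_] /=.
    by rewrite mulr1.
  by rewrite mulr0 mul0r.
have nodiv i : ~~ (lead_mon (f i) <= m)%MM.
  apply/negP => fim; have: i \in [seq i <- enum 'I_k | (lead_mon (f i) <= m)%MM].
    by rewrite mem_filter fim mem_enum.
  by case: (filter _ _) E.
apply: IH => //=; split=> /= [|m' i /msuppD_le].
  rewrite pE; set t := _ *: _; rewrite /=; ring.
rewrite mem_cat => /orP[/rE //|/msuppZ_le].
by rewrite msuppX inE => /eqP->.
Qed.

End Division.

Section RationalVectorFields.
Variables (n : nat) (K : fieldType).
Local Notation P := {mpoly K[n]}.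
Local Notation Q := {fraction P}.

(* Quotient rule on the canonical representative; [fderiv_frac] shows that the
   choice of representative is immaterial. *)
Definition fderiv (i : 'I_n) (x : Q) : Q :=
  let num := \n_(repr x) in let den := \d_(repr x) in
  tofrac (num^`M(i) * den - num * den^`M(i)) / tofrac (den ^+ 2).

Lemma pi_frac_mul (r : {ratio P}) :
  (\pi%qT r : Q) * tofrac \d_r = tofrac \n_r.
Proof.
unlock FracField.tofrac; rewrite -[LHS]FracField.pi_mul; apply/eqmodP.
rewrite /= FracField.equivfE /FracField.mulf.
by rewrite !numden_Ratio ?oner_eq0 ?mulr1 ?denom_ratioP // mulrC.
Qed.

Lemma fderiv_frac (i : 'I_n) (num den : P) : den != 0 ->
  fderiv i (tofrac num / tofrac den) =
  tofrac (num^`M(i) * den - num * den^`M(i)) / tofrac (den ^+ 2).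
Proof.
move=> den0; rewrite /fderiv; cbv zeta; set x := tofrac num / _.
have d0 : \d_(repr x) != 0 by apply: denom_ratioP.
have xE : x = tofrac \n_(repr x) / tofrac \d_(repr x).
  apply: (canRL (mulfK _)); first by rewrite tofrac_eq0.
  by rewrite -{1}[x]reprK pi_frac_mul.
set a := \n_(repr x) in xE *; set b := \d_(repr x) in d0 xE *.
have tf (y : P) : y != 0 -> tofrac y != 0 by rewrite tofrac_eq0.
have E : num * b = a * den.
  apply/eqP; rewrite -tofrac_eq !tofracM; apply/eqP.
  move: xE; rewrite /x => /eqP; rewrite eqr_div ?tf // => /eqP ->.
  by rewrite mulrC.
have dE := congr1 (mderiv i) E; rewrite !mderivM in dE.
apply/eqP; rewrite eqr_div ?tf ?sqrf_eq0 // -!tofracM tofrac_eq; apply/eqP.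
have -> : (a^`M(i) * b - a * b^`M(i)) * den ^+ 2 =
  b * den * (a^`M(i) * den + a * den^`M(i)) - a * den * (b^`M(i) * den + b * den^`M(i)) by ring.
rewrite -dE -E; ring.
Qed.

Definition divergence (v : 'rV[Q]_n) : Q := \sum_i fderiv i (v 0 i).

Definition mdivergence (v : 'rV[P]_n) : P := \sum_i (v 0 i)^`M(i).

Definition differential (F : P) (v : 'rV[Q]_n) : Q :=
  \sum_i v 0 i * tofrac F^`M(i).

(* The local ring at the prime ideal (F), as a subring of the fraction field. *)
Definition in_local (F : P) (x : Q) : Prop :=
  exists num den : P, ~ (exists g : P, den = g * F) /\ x = tofrac num / tofrac den.

Definition local_dvd (F : P) (x y : Q) : Prop :=
  exists2 z : Q, in_local F z & y = x * z.

Definition euler_field (I : {set 'I_n}) : 'rV[Q]_n :=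
  \row_i (if i \in I then tofrac 'X_i else 0).

End RationalVectorFields.

Section Construction.
Variables (K : fieldType) (le : rel 'X_{1..6}).
Local Notation P := {mpoly K[6]}.
Local Notation Q := {fraction P}.

Definition fermat : P := \sum_(i < 6) 'X_i ^+ 6.

Definition fermat_partials (i : 'I_6) : P := fermat^`M(i).

Lemma fermat_partialsE i : fermat_partials i = 6%:R *: 'X_[U_(i) *+ 5].
Proof.
rewrite /fermat_partials /fermat raddf_sum /= (bigD1 i) //= big1 ?addr0.
  rewrite mpolyXn mderivX mulmnE mnm1E eqxx mul1n.
  congr (_ *: 'X_[_]).
  by apply/mnmP => j; rewrite !(mnmE, mulmnE, mnm1E); case: eqP.
move=> j ji; rewrite mpolyXn mderivX mulmnE mnm1E (negPf ji).
by rewrite mul0n scale0r.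
Qed.

Definition jacobian_quo (p : P) : 'rV[P]_6 := mdiv_quo le fermat_partials p.
Definition jacobian_rem (p : P) : P := mdiv_rem le fermat_partials p.

Definition Tmap (q : nat) (A : P) : P :=
  mdivergence (jacobian_quo (q%:R^-1 *: A)).

Fixpoint Tmap_iter (q : nat) (A : P) : P :=
  if q is q'.+1 then Tmap_iter q' (Tmap q A) else A.

Definition weight (I : {set 'I_6}) (a : 'X_{1..6}) : nat := (\sum_(i in I) a i)%N.

(* [I q a] is the subset chosen for the monomial [a] in the call of the reduced
   construction at level [q]; there is at most one such call for each [q]. *)
Definition admissible_choice (I : nat -> 'X_{1..6} -> {set 'I_6}) : Prop :=
  forall (q : nat) (a : 'X_{1..6}),
    (0 < q <= 2)%N -> mdeg a = (6 * q)%N -> (forall i, (a i <= 4)%N) ->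
    [/\ I q a != set0, I q a != setT & (weight (I q a) a + #|I q a| = 6)%N].

Lemma admissible_choice_exists : exists I, admissible_choice I.
Proof.
pose ok (a : 'X_{1..6}) (J : {set 'I_6}) :=
  [&& J != set0, J != setT & weight J a + #|J| == 6]%N.
pose I (q : nat) a := odflt set0 [pick J | ok a J].
exists I => q a q12 a_deg a_le; rewrite /I.
suff [J okJ] : exists J, ok a J.
  by case: pickP => [J' /and3P[? ? /eqP]|/(_ J)]; rewrite ?okJ.
pose bs := [:: true; false]; pose s := iota 1 5.
pose test x0 x1 x2 x3 x4 x5 := has (fun b0 : bool => has (fun b1 : bool => has (fun b2 : bool =>
  has (fun b3 : bool => has (fun b4 : bool => has (fun b5 : bool =>
    b0 * x0 + b1 * x1 + b2 * x2 + b3 * x3 + b4 * x4 + b5 * x5 == 6)%N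
  bs) bs) bs) bs) bs) bs.
have check : all (fun x0 => all (fun x1 => all (fun x2 => all (fun x3 =>
    all (fun x4 => all (fun x5 =>
      let t := (x0 + x1 + x2 + x3 + x4 + x5)%N in
      if (t == 12) || (t == 18) then test x0 x1 x2 x3 x4 x5 else true)
    s) s) s) s) s) s by vm_compute.
pose x (i : 'I_6) := (a i).+1.
have xs i : x i \in s by rewrite mem_iota; exact: (a_le i).
pose o (k : nat) : 'I_6 := inord k.
have sum6 (G : 'I_6 -> nat) : (\sum_i G i =
    G (o 0) + G (o 1) + G (o 2) + G (o 3) + G (o 4) + G (o 5))%N.
  rewrite !big_ord_recr big_ord0 /= add0n.
  by do !congr addn; congr G; apply: val_inj; rewrite /= inordK.
have sumx : (\sum_i x i = 6 * q + 6)%N.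
  rewrite -a_deg mdegE -[X in (_ + X)%N](card_ord 6) -sum1_card -big_split /=.
  by apply: eq_bigr => i _; rewrite /x addn1.
move/allP/(_ _ (xs (o 0%N)))/allP/(_ _ (xs (o 1%N)))/allP/(_ _ (xs (o 2%N))): check.
move/allP/(_ _ (xs (o 3%N)))/allP/(_ _ (xs (o 4%N)))/allP/(_ _ (xs (o 5%N))).
rewrite /= -(sum6 x) sumx.
have -> : (6 * q + 6 == 12)%N || (6 * q + 6 == 18)%N by case: q q12 {a_deg sumx} => [|[|[]]].
rewrite /test => /hasP[b0 _ /hasP[b1 _ /hasP[b2 _ /hasP[b3 _ /hasP[b4 _ /hasP[b5 _ /eqP E]]]]]].
pose J := [set i : 'I_6 | nth false [:: b0; b1; b2; b3; b4; b5] i].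
have JE : (weight J a + #|J| = 6)%N.
  apply: etrans E; rewrite /weight -sum1_card -big_split /= big_mkcond /= sum6 !inE !inordK //=.
  by do !congr addn; case: ifP; rewrite ?mul1n ?mul0n // /x addn1.
exists J; rewrite /ok JE eqxx andbT; apply/andP; split; apply/eqP => J0.
  by move: JE; rewrite J0 /weight big_set0 cards0.
have: (\sum_i x i = 6)%N.
  apply: etrans JE; rewrite J0 /weight -sum1_card -big_split /=.
  by apply: eq_big => [i|i _]; rewrite ?inE // /x addn1.
rewrite sumx => /eqP; rewrite -[X in _ == X]add0n eqn_add2r muln_eq0 /=.
by case/andP: q12; rewrite lt0n => /negPf ->.
Qed.

Definition reduced_construction (I : 'X_{1..6} -> {set 'I_6}) (q : nat) (B : P) :
    'rV[Q]_6 :=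
  \sum_(a <- msupp B)
    (tofrac (B@_a *: 'X_[a]) /
       (q%:R * differential fermat (euler_field K (I a)))) *: euler_field K (I a).

Fixpoint recursive_construction (I : nat -> 'X_{1..6} -> {set 'I_6})
    (q : nat) (A : P) : 'rV[Q]_6 :=
  if q is q'.+1 then
    let v' := jacobian_quo (q%:R^-1 *: A) in
    let r := jacobian_rem (q%:R^-1 *: A) in
    let v'' := recursive_construction I q' (mdivergence v') in
    let v''' := reduced_construction (I q) q (q%:R *: r) in
    map_mx (@tofrac P) v' + tofrac fermat *: v'' + v'''
  else 0.

End Construction.

Arguments fermat {K}.

(* Main.v *)
(** For every [q] the combination [A - q dF(v) + F div(v)] is exactly [0].
    Write [A = q dF(v') + q r], [v = v' + F v'' + v'''].  Expanding with the
    Leibniz rule, the combination for [(q, A)] is [F] times the one for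
    [(q-1, div v')], plus [q r - q dF(v''') + F div(v''')].  The reduced
    construction gives [q dF(v''') = q r] outright, and [div(v''') = 0]: by
    Euler's relation for [nu_I], the divergence of [Z^a nu_I / nu_I(F)] is
    [(w_I(a) + |I| - 6) Z^a / nu_I(F)].  The recursion bottoms out at
    [A = T^(q)(A) = 0], [v = 0]. *)
Require Import Defs.
From mathcomp Require Import all_boot all_order all_algebra fraction.
From mathcomp Require Import complex mpoly.
From mathcomp Require Import reals.
From mathcomp Require Import generic_quotient ring.

Set Implicit Arguments.
Unset Strict Implicit.
Unset Printing Implicit Defensive.

Import GRing.Theory Num.Theory.
Local Open Scope ring_scope.

(** * Differential calculus on the field of rational functions *)

Section FractionDerivative.
Variables (n : nat) (K : fieldType).
Local Notation P := {mpoly K[n]}.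
Local Notation Q := {fraction P}.
Implicit Types (i : 'I_n) (x y : Q).

Lemma frac_numden x : exists a b : P, b != 0 /\ x = tofrac a / tofrac b.
Proof.
have d0 : \d_(repr x) != 0 by apply: denom_ratioP.
exists \n_(repr x), \d_(repr x); split=> //.
apply: (canRL (mulfK _)); first by rewrite tofrac_eq0.
by rewrite -{1}[x]reprK pi_frac_mul.
Qed.

Lemma fderiv_tofrac i (p : P) : fderiv i (tofrac p) = tofrac p^`M(i).
Proof.
have := fderiv_frac i p (oner_neq0 P); rewrite !tofrac1 !divr1 => ->.
by rewrite expr1n tofrac1 divr1 mulr1 -(mpolyC1 n K) mderivC mulr0 subr0.
Qed.

(** Primed letters stand for derivatives of the unprimed ones. Stating the identity over an abstract
    field leaves [field] with plain atoms; the product version below serves the same purpose. *)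
Lemma quotient_ruleD (F : fieldType) (a b c d a' b' c' d' : F) :
  b != 0 -> d != 0 ->
  ((a' * d + a * d' + (c' * b + c * b')) * (b * d) -
     (a * d + c * b) * (b' * d + b * d')) / (b * d) ^+ 2 =
  (a' * b - a * b') / b ^+ 2 + (c' * d - c * d') / d ^+ 2.
Proof. by move=> b0 d0; field; rewrite b0 d0. Qed.

Lemma quotient_ruleM (F : fieldType) (a b c d a' b' c' d' : F) :
  b != 0 -> d != 0 ->
  ((a' * c + a * c') * (b * d) - (a * c) * (b' * d + b * d')) / (b * d) ^+ 2 =
  (a' * b - a * b') / b ^+ 2 * (c / d) + a / b * ((c' * d - c * d') / d ^+ 2).
Proof. by move=> b0 d0; field; rewrite b0 d0. Qed.

Lemma fderivD i x y : fderiv i (x + y) = fderiv i x + fderiv i y.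
Proof.
have [a [b [b0 ->]]] := frac_numden x; have [c [d [d0 ->]]] := frac_numden y.
have tb : tofrac b != 0 by rewrite tofrac_eq0.
have td : tofrac d != 0 by rewrite tofrac_eq0.
rewrite (addf_div _ _ tb td) -!tofracM -tofracD !fderiv_frac ?mulf_neq0 //.
rewrite mderivD !mderivM.
by rewrite !(tofracB, tofracD, tofracM, tofracXn)
  (quotient_ruleD _ _ _ _ _ _ tb td).
Qed.

Lemma fderivM i x y : fderiv i (x * y) = fderiv i x * y + x * fderiv i y.
Proof.
have [a [b [b0 ->]]] := frac_numden x; have [c [d [d0 ->]]] := frac_numden y.
have tb : tofrac b != 0 by rewrite tofrac_eq0.
have td : tofrac d != 0 by rewrite tofrac_eq0.
rewrite mulf_div -!tofracM !fderiv_frac ?mulf_neq0 //.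
rewrite !mderivM.
by rewrite !(tofracB, tofracD, tofracM, tofracXn)
  (quotient_ruleM _ _ _ _ _ _ tb td).
Qed.

Lemma divergenceD (u v : 'rV[Q]_n) :
  divergence (u + v) = divergence u + divergence v.
Proof.
by rewrite -big_split; apply: eq_bigr => i _; rewrite mxE fderivD.
Qed.

Lemma divergence0 : divergence (0 : 'rV[Q]_n) = 0.
Proof. by apply: (@addrI _ (divergence 0)); rewrite -divergenceD !addr0. Qed.

Lemma divergenceZ x (v : 'rV[Q]_n) :
  divergence (x *: v) = (\sum_i fderiv i x * v 0 i) + x * divergence v.
Proof.
rewrite mulr_sumr -big_split; apply: eq_bigr => i _.
by rewrite mxE fderivM.
Qed.

Lemma divergence_tofrac (v : 'rV[P]_n) :
  divergence (map_mx (@tofrac P) v) = tofrac (mdivergence v).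
Proof.
by rewrite rmorph_sum; apply: eq_bigr => i _; rewrite mxE fderiv_tofrac.
Qed.

Lemma differentialD (F : P) (u v : 'rV[Q]_n) :
  differential F (u + v) = differential F u + differential F v.
Proof.
by rewrite -big_split; apply: eq_bigr => i _; rewrite mxE mulrDl.
Qed.

Lemma differentialZ (F : P) x (v : 'rV[Q]_n) :
  differential F (x *: v) = x * differential F v.
Proof.
by rewrite mulr_sumr; apply: eq_bigr => i _; rewrite mxE mulrA.
Qed.

Lemma differential0 (F : P) : differential F 0 = 0.
Proof. by rewrite -(scale0r 0) differentialZ mul0r. Qed.

Lemma differential_tofrac (F : P) (v : 'rV[P]_n) :
  differential F (map_mx (@tofrac P) v) = tofrac (\sum_i v 0 i * F^`M(i)).
Proof. by rewrite rmorph_sum; apply: eq_bigr => i _; rewrite mxE rmorphM. Qed.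

Lemma differential_euler (F : P) (J : {set 'I_n}) :
  differential F (euler_field K J) = tofrac (\sum_(i in J) 'X_i * F^`M(i)).
Proof.
rewrite rmorph_sum big_mkcond; apply: eq_bigr => i _; rewrite mxE.
by case: ifP => _; rewrite ?mul0r ?rmorphM.
Qed.

Lemma sum_fderiv_tofrac (F : P) (v : 'rV[Q]_n) :
  \sum_i fderiv i (tofrac F) * v 0 i = differential F v.
Proof. by apply: eq_bigr => i _; rewrite fderiv_tofrac mulrC. Qed.

Lemma divergence_euler (J : {set 'I_n}) :
  divergence (euler_field K J) = #|J|%:R.
Proof.
rewrite -sum1_card natr_sum big_mkcond; apply: eq_bigr => i _; rewrite mxE.
case: ifP => _; last by rewrite -tofrac0 fderiv_tofrac raddf0.
rewrite fderiv_tofrac mderivX mnm1E eqxx scale1r.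
by rewrite -{1}[U_(i)%MM]add0m addmK mpolyX0 tofrac1.
Qed.

Lemma euler_monomial (J : {set 'I_n}) (a : 'X_{1..n}) :
  \sum_(i in J) 'X_i * ('X_[a] : P)^`M(i) = (\sum_(i in J) a i)%N%:R *: 'X_[a].
Proof.
rewrite natr_sum scaler_suml; apply: eq_bigr => i _.
(* Subtraction of exponents truncates, so [U_(i) + (a - U_(i))] is [a] only if [a i] is nonzero;
   otherwise the factor [a i] kills both terms. *)
rewrite mderivX -scalerAr -mpolyXD; have [->|ai] := eqVneq (a i) 0%N.
  by rewrite !scale0r.
by rewrite addmC submK // lep1mP.
Qed.

End FractionDerivative.

(** * Degrees under division and differentiation *)

Section HomogeneousDivision.
Variables (n k : nat) (K : fieldType) (le : rel 'X_{1..n}).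
Variables (e : nat) (f : 'I_k -> {mpoly K[n]}).
Hypothesis f_term :
  forall i, exists2 c, c != 0 & exists2 a, f i = c *: 'X_[a] & mdeg a = e.

(** Each step moves or cancels a single term of degree [d], and a quotient term has the degree of
    that term minus the degree [e] of the divisor; so homogeneity is an invariant of the division
    state. *)
Lemma mdivision_homog d (p : {mpoly K[n]}) : p \is d.-homog ->
  (forall i, mdiv_quo le f p 0 i \is (d - e).-homog) /\
  mdiv_rem le f p \is d.-homog.
Proof.
move=> pd; rewrite /mdiv_quo /mdiv_rem /mdivision_state.
suff main N : let s := iter N (mdiv_step le f) (p, 0, 0) in
    s.1.1 \is d.-homog /\
    (forall i, s.1.2 0 i \is (d - e).-homog) /\ s.2 \is d.-homog.
  by have [] := main (size (msupp p)).
elim: N => [|N] /=; first by split=> //; split=> [i|]; rewrite ?mxE rpred0.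
case: (iter N _ _) => [[p1 q1] r1] /= [p1d [q1d r1d]].
have [//|p10] := eqVneq p1 0.
set m := lead_mon le p1.
have md : mdeg m = d by apply: (dhomogP _ _ _ p1d); exact: lead_mon_supp.
have Xd : p1@_m *: 'X_[m] \is d.-homog by rewrite dhomogZ // dhomogX /= md eqxx.
case E : (ohead _) => [i|] /=; last first.
  by split; [exact: rpredB | split; rewrite ?rpredD].
have : (lead_mon le (f i) <= m)%MM.
  suff: i \in [seq i <- enum 'I_k | (lead_mon le (f i) <= m)%MM].
    by rewrite mem_filter => /andP[].
  by case: (filter _ _) E => //= a l [->]; rewrite mem_head.
have [c c0 [a -> ae]] := f_term i; rewrite lead_monZX // => am.
rewrite mcoeffZ mcoeffX eqxx mulr1.
have mad : mdeg (m - a) = (d - e)%N.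
  by rewrite -md -(submK am) mdegD ae addnK submK.
have ud : (p1@_m / c) *: 'X_[m - a] \is (d - e).-homog.
  by rewrite dhomogZ // dhomogX /= mad eqxx.
split; last split=> [j|] //.
  rewrite rpredB // -scalerAl -scalerAr scalerA -mpolyXD submK //.
  by rewrite divfK.
rewrite !mxE eqxx /= rpredD //; case: eqP => _ /=; first by rewrite mulr1.
by rewrite mulr0 rpred0.
Qed.

End HomogeneousDivision.

Lemma mderiv_homog n (R : nzRingType) d i (p : {mpoly R[n]}) :
  p \is d.-homog -> p^`M(i) \is d.-1.-homog.
Proof.
move=> /dhomogP pd; rewrite [p]mpolyE raddf_sum big_seq.
apply: rpred_sum => m mp /=.
(* A term free of the variable [i] has derivative zero, which is homogeneous of any degree; this
   also covers [d = 0], where [d.-1] is [0]. *)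
rewrite mderivZ mderivX; apply: rpredZ; have [->|mi] := eqVneq (m i) 0%N.
  by rewrite scale0r rpred0.
have mE : mdeg m = (mdeg (m - U_(i))).+1.
  have miU : (U_(i) <= m)%MM by rewrite lep1mP.
  by rewrite -{1}(submK miU) mdegD mdeg1 addn1.
by rewrite rpredZ // dhomogX -(pd _ mp) /= mE eqxx.
Qed.

(** The inductive step with its analysis removed: [d'], [d''], [dw] are dF of v', v'', v''', while
    [e'], [e''] are the divergences of v', v'', and the final [0] is div(v'''). The summand [d''] in
    the last bracket comes from div(F v'') = dF(v'') + F div(v''); it lowers the coefficient of
    [F * d''] from q+1 to q. *)
Lemma recursion_identity (S : comNzRingType) q (F d' d'' dw e' e'' : S) :
  e' - q%:R * d'' + F * e'' = 0 ->
  q.+1%:R * d' + q.+1%:R * dw - q.+1%:R * (d' + F * d'' + dw) +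
    F * (e' + (d'' + F * e'') + 0) = 0.
Proof.
move=> E; transitivity (F * (e' - q%:R * d'' + F * e'')).
  by rewrite -natr1; ring.
by rewrite E mulr0.
Qed.

(** * The Fermat sextic: Euler fields, reduced construction, recursion *)

Section Fermat.
Variables (K : numFieldType) (le : rel 'X_{1..6}).
Local Notation P := {mpoly K[6]}.
Local Notation Q := {fraction P}.

Lemma fermat_partials_term i : exists2 c, c != 0 &
  exists2 a, fermat_partials K i = c *: 'X_[a] & mdeg a = 5%N.
Proof.
exists 6%:R; first by rewrite pnatr_eq0.
exists (U_(i) *+ 5)%MM; first exact: fermat_partialsE.
by rewrite mdegMn mdeg1.
Qed.

(** Source of the exponent bound required by the reduced construction: no remainder monomial is
    divisible by any Z_i^5. *)
Lemma jacobian_division (p : P) :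
  p = \sum_i jacobian_quo le p 0 i * fermat^`M(i) + jacobian_rem le p /\
  forall m i, m \in msupp (jacobian_rem le p) -> (m i <= 4)%N.
Proof.
have [|_ [pE rE]] := @mdivision_spec _ _ _ le (fermat_partials K) p.
  move=> i; have [c c0 [a aE _]] := fermat_partials_term i.
  by exists c => //; exists a.
split=> // m i mr; have := rE m i mr.
rewrite fermat_partialsE lead_monZX ?pnatr_eq0 //.
apply: contraR; rewrite -ltnNge => mi; apply/mnm_lepP => j.
by rewrite mulmnE mnm1E; case: eqP => [<-|]; rewrite ?mul0n ?mul1n.
Qed.

Lemma fermat_euler (J : {set 'I_6}) :
  \sum_(i in J) 'X_i * (fermat : P)^`M(i) =
  6%:R *: \sum_(i in J) 'X_[U_(i) *+ 6].
Proof.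
rewrite scaler_sumr; apply: eq_bigr => i _.
rewrite -[_^`M(i)]/(fermat_partials K i) fermat_partialsE -scalerAr -mpolyXD.
by rewrite -mulmS.
Qed.

Lemma fermat_euler_neq0 (J : {set 'I_6}) :
  J != set0 -> differential (fermat : P) (euler_field K J) != 0.
Proof.
case/set0Pn => i iJ; rewrite differential_euler tofrac_eq0 fermat_euler.
(* For [i] in [J], the coefficient of Z_i^6 in nu_J(F) is 6, nonzero in characteristic zero. *)
apply/eqP => /(congr1 (mcoeff (U_(i) *+ 6))).
rewrite mcoeffZ raddf_sum (bigD1 i) //= mcoeffX eqxx big1 ?addr0 => [|j].
  by rewrite mcoeff0 mulr1 => /eqP; rewrite pnatr_eq0.
case/andP=> _ ji; rewrite mcoeffX; case: eqP => // /mnmP/(_ i).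
by rewrite !mulmnE !mnm1E eqxx (negPf ji).
Qed.

(** nu_J(F) is 6 times the sum of Z_j^6 over [J], hence homogeneous of degree 6 in the variables
    indexed by [J]; Euler's relation gives the eigenvalue 6. *)
Lemma fermat_euler_eigen (J : {set 'I_6}) :
  let nuF := differential (fermat : P) (euler_field K J) in
  \sum_i fderiv i nuF * (euler_field K J) 0 i = 6%:R * nuF.
Proof.
rewrite /= differential_euler sum_fderiv_tofrac differential_euler fermat_euler.
rewrite -[6%:R * _]/(6%:R * tofrac _) mulr_natl -rmorphMn /=.
rewrite -scaler_nat; congr tofrac.
under eq_bigr do rewrite mderivZ -scalerAr raddf_sum mulr_sumr /=.
rewrite -scaler_sumr; congr (_ *: _).
rewrite scaler_sumr exchange_big /=; apply: eq_bigr => j jJ.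
rewrite euler_monomial (bigD1 j) //= big1 ?addn0 => [|i /andP[_ ij]].
  by rewrite mulmnE mnm1E eqxx.
by rewrite mulmnE mnm1E eq_sym (negPf ij).
Qed.

(** The constant [s] plays the role of q. The quotient is never differentiated directly: the
    derivation along nu_J is applied to the product of the quotient with its denominator. *)
Lemma reduced_term_divergence (J : {set 'I_6}) (c : K) (a : 'X_{1..6}) (s : Q) :
    J != set0 -> (weight J a + #|J| = 6)%N ->
    (forall i, fderiv i s = 0) -> s != 0 ->
  divergence ((tofrac (c *: 'X_[a]) /
    (s * differential (fermat : P) (euler_field K J))) *: euler_field K J) = 0.
Proof.
move=> /fermat_euler_neq0 nu0 w6 ds s0; set nu := differential _ _ in nu0 *.
set x := _ / _; rewrite divergenceZ divergence_euler.
set D := fun y : Q => \sum_i fderiv i y * euler_field K J 0 i.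
have DM y z : D (y * z) = D y * z + y * D z.
  rewrite /D mulr_suml mulr_sumr -big_split; apply: eq_bigr => i _ /=.
  by rewrite fderivM; ring.
have Ds : D s = 0 by rewrite /D big1 // => i _; rewrite ds mul0r.
have Dnu : D nu = 6%:R * nu := fermat_euler_eigen J.
have xE : x * (s * nu) = tofrac (c *: 'X_[a]) := divfK (mulf_neq0 s0 nu0) _.
have := congr1 D xE; rewrite 2!DM Ds Dnu mul0r add0r.
have -> : D (tofrac (c *: 'X_[a])) = (weight J a)%:R * tofrac (c *: 'X_[a]).
  rewrite /D sum_fderiv_tofrac differential_euler.
  under eq_bigr do rewrite mderivZ -scalerAr.
  rewrite -scaler_sumr euler_monomial scalerA [c * _]mulrC -scalerA.
  by rewrite scaler_nat rmorphMn mulr_natl.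
(* The choice of [J] enters here: the eigenvalue 6 of nu_J(F) splits into the eigenvalue of Z^a and
   the divergence of nu_J. *)
have -> : 6%:R = (weight J a)%:R + #|J|%:R :> Q by rewrite -natrD w6.
rewrite -xE => E.
apply: (mulIf (mulf_neq0 s0 nu0)); rewrite mul0r -/(D x).
have -> : (D x + x * #|J|%:R) * (s * nu) = D x * (s * nu) +
    x * (s * (((weight J a)%:R + #|J|%:R) * nu)) -
    (weight J a)%:R * (x * (s * nu)) by ring.
by rewrite E subrr.
Qed.

Lemma reduced_construction_divergence (J : 'X_{1..6} -> {set 'I_6}) q (B : P) :
    (0 < q)%N ->
    {in msupp B, forall a, J a != set0 /\ (weight (J a) a + #|J a| = 6)%N} ->
  divergence (reduced_construction J q B) = 0.
Proof.
move=> q0 Jok; rewrite /reduced_construction big_seq.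
apply: (big_ind (fun v => divergence v = 0)) => [|u v u0 v0|a /Jok[Ja0 w6]].
- exact: divergence0.
- by rewrite divergenceD u0 v0 addr0.
(* Seen as a constant polynomial, q has zero derivatives and is visibly nonzero. *)
have qE : q%:R = tofrac (q%:R : P) by rewrite rmorph_nat.
apply: reduced_term_divergence => // [i|]; rewrite qE.
  by rewrite fderiv_tofrac -mpolyC_nat mderivC tofrac0.
by rewrite tofrac_eq0 -mpolyC_nat mpolyC_eq0 pnatr_eq0 -lt0n.
Qed.

(** Term by term, dF(nu_I) = nu_I(F) cancels the denominator, leaving c_a Z^a / q. *)
Lemma reduced_construction_differential
    (J : 'X_{1..6} -> {set 'I_6}) q (B : P) :
    (0 < q)%N -> {in msupp B, forall a, J a != set0} ->
  q%:R * differential fermat (reduced_construction J q B) = tofrac B.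
Proof.
move=> q0 Jok; rewrite /reduced_construction.
rewrite (big_morph _ (@differentialD _ _ _) (@differential0 _ _ _)).
rewrite [in RHS](mpolyE B) rmorph_sum mulr_sumr.
apply: eq_big_seq => a /Jok Ja0.
have qn0 : q%:R != 0 :> Q.
  rewrite -(rmorph_nat (@tofrac P)) tofrac_eq0 -mpolyC_nat mpolyC_eq0.
  by rewrite pnatr_eq0 -lt0n.
have nu0 := fermat_euler_neq0 Ja0.
by rewrite differentialZ mulrCA (divfK (mulf_neq0 qn0 nu0)).
Qed.

Lemma fermat_local_dvd0 x : local_dvd (fermat : P) x 0.
Proof.
exists 0; rewrite ?mulr0 //; exists 0, 1; split; last by rewrite tofrac0 mul0r.
(* The denominator 1 is not in (F): F vanishes at the origin, so evaluating 1 = gF there would give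
   1 = 0. *)
case=> g /(congr1 (meval (fun=> 0))) /eqP.
rewrite mevalM meval1 /fermat raddf_sum big1 => [|i _ /=].
  by rewrite mulr0 oner_eq0.
by rewrite rmorphXn /= mevalXU expr0n.
Qed.

Lemma recursive_construction_exact (I : nat -> 'X_{1..6} -> {set 'I_6}) :
    admissible_choice I -> forall q (A : P), (q <= 2)%N ->
    A \is (6 * q)%N.-homog -> Tmap_iter le q A = 0 ->
  let v := recursive_construction le I q A in
  tofrac A - q%:R * differential fermat v + tofrac fermat * divergence v = 0.
Proof.
move=> I_adm; elim=> [|q IH] A q2 Ad; cbv zeta.
  by move=> /= ->; rewrite tofrac0 mul0r subrr add0r divergence0 mulr0.
have qn0 : q.+1%:R != 0 :> K by rewrite pnatr_eq0.
rewrite [Tmap_iter _ _ _]/= [recursive_construction _ _ _ _]/= /Tmap.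
have pd : q.+1%:R^-1 *: A \is (6 * q.+1)%N.-homog by rewrite rpredZ.
have [pE r4] := jacobian_division (q.+1%:R^-1 *: A).
have [quo_d rem_d] := mdivision_homog le fermat_partials_term pd.
move: pE r4 quo_d rem_d; rewrite -/(jacobian_quo le _) -/(jacobian_rem le _).
set v' := jacobian_quo _ _; set r := jacobian_rem _ _ => pE r4 quo_d rem_d T0.
(* Quotients have degree 6(q+1) - 5 and differentiation lowers it by one, so div(v') is a legitimate
   input at level q. *)
have div_d : mdivergence v' \is (6 * q)%N.-homog.
  apply: rpred_sum => i _; have := mderiv_homog i (quo_d i).
  by have -> : (6 * q.+1 - 5).-1 = (6 * q)%N by rewrite mulnS.
have := IH _ (ltnW q2) div_d T0; cbv zeta.
set v'' := recursive_construction _ _ _ _ => {}IH.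
have AE : tofrac A =
    q.+1%:R * tofrac (\sum_i v' 0 i * fermat^`M(i)) + tofrac (q.+1%:R *: r).
  rewrite mulr_natl -rmorphMn -rmorphD /= -scaler_nat -scalerDr -pE.
  by rewrite scalerA divff // scale1r.
(* Remainder monomials have degree 6(q+1) by homogeneity and exponents at most 4 by the division, so
   the admissibility of [I] applies to them. *)
have I_ok : {in msupp (q.+1%:R *: r), forall a,
    I q.+1 a != set0 /\ (weight (I q.+1 a) a + #|I q.+1 a| = 6)%N}.
  move=> a /msuppZ_le ar.
  have ad : mdeg a = (6 * q.+1)%N := dhomogP _ _ _ rem_d _ ar.
  by have [] := I_adm q.+1 a q2 ad (fun i => r4 a i ar).
have B0 := reduced_construction_divergence (ltn0Sn q) I_ok.
have BE := reduced_construction_differential (ltn0Sn q)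
  (fun a ar => (I_ok a ar).1).
rewrite AE -BE !differentialD !divergenceD B0 differentialZ divergenceZ.
rewrite differential_tofrac divergence_tofrac sum_fderiv_tofrac.
exact: recursion_identity IH.
Qed.

End Fermat.

Theorem theorem3p10 (R : realType)
    (le : rel 'X_{1..6}) (le_order : monomial_order le)
    (I : nat -> 'X_{1..6} -> {set 'I_6}) (I_adm : admissible_choice I)
    (q : nat) (q_le2 : (q <= 2)%N)
    (A : {mpoly R[i][6]}) (A_homog : A \is (6 * q)%N.-homog)
    (TA0 : Tmap_iter le q A = 0) :
  let v := recursive_construction le I q A in
  local_dvd fermat (tofrac fermat ^+ q.+1)
    (tofrac A - q%:R * differential fermat v + tofrac fermat * divergence v).
Proof.
cbv zeta; rewrite (recursive_construction_exact I_adm q_le2 A_homog TA0).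
exact: fermat_local_dvd0.
Qed.
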